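(* Let $S$ be a closed symmetric linear relation in a Krein space $\mathfrak H$ with equal defect numbers $d\in\mathbb N$, and let $\mathsf b:S^*\to\mathbb C^{2d}$ be a boundary mapping for $S$ with Gram matrix $\mathsf Q$. Let $\widetilde A_1,\widetilde A_2\in\mathbb A_{S,\mathsf b}$. The following statements are equivalent. (i) $T_{\widetilde A_1}(z)=T_{\widetilde A_2}(z)$ for all $z\in\mathbb C$. (ii) $\widetilde A_1\sim\widetilde A_2$. (iii) $\widetilde A_1\cap\mathfrak H^2=\widetilde A_2\cap\mathfrak H^2$ and there exists an isomorphism $\Theta:\widehat{\mathfrak H}_1\to\widehat{\mathfrak H}_2$ such that $\Theta\widehat S_1=\widehat S_2\Theta$ and for all $\{\widehat f,\widehat g\}\in\widehat S_1^*$ we have $\widehat{\mathsf b}_2(\{\Theta\widehat f,\Theta\widehat g\})=\widehat{\mathsf b}_1(\{\widehat f,\widehat g\})$. If one (and hence all) of the statements (i), (ii), (iii) holds, then $T_{\widetilde A_1}(\infty)=T_{\widetilde A_2}(\infty)$.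
   Context: Linear relations. A (closed) linear relation $R$ in a Krein space $\mathfrak K$ is a (closed) linear subspace of $\mathfrak K^2$, with elements written $\{f,g\}$; operators are identified with their graphs. $R^*=\{\{h,k\}:[g,h]=[f,k]\text{ for all }\{f,g\}\in R\}$; $R$ is symmetric if $R\subseteq R^*$, self-adjoint if $R=R^*$. Products of relations are compositions. An isomorphism of Krein spaces is a linear bijection preserving the inner product. Defect numbers and boundary mappings. A closed symmetric relation $S$ has equal finite defect numbers $d$ if $\dim S^*/S=2d$ and the form $\mathrm i([f,k]-[g,h])$ on $S^*/S$ has $d$ positive and $d$ negative squares. A boundary mapping for $S$ (for $d\ge 1$) is a linear surjection $\mathsf b:S^*\to\mathbb C^{2d}$ with kernel $S$; its Gram matrix is the invertible self-adjoint matrix $\mathsf Q$ with $\mathrm i([f,k]-[g,h])=\mathsf b(\{h,k\})^*\mathsf Q\,\mathsf b(\{f,g\})$ for all $\{f,g\},\{h,k\}\in S^*$. The class $\mathbb A_{S,\mathsf b}$: all self-adjoint relations $\widetilde A$ in a Krein space $\widetilde{\mathfrak H}$ such that (a) $\mathfrak H$ is a Krein subspace of $\widetilde{\mathfrak H}$, with orthogonal complement $\widehat{\mathfrak H}$, $\widetilde{\mathfrak H}=\mathfrak H\oplus\widehat{\mathfrak H}$; (b) $S\subseteq\widetilde A$; (c) $\dim\widehat{\mathfrak H}<\infty$; (d) $\widehat S=\widetilde A\cap\widehat{\mathfrak H}^2$ is a (closed symmetric) operator without eigenvalues. $\widetilde A_1\sim\widetilde A_2$ means there is an isomorphism $\Psi:\widehat{\mathfrak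 H}_1\to\widehat{\mathfrak H}_2$ with $(I_{\mathfrak H}\oplus\Psi)\widetilde A_1=\widetilde A_2(I_{\mathfrak H}\oplus\Psi)$. Objects associated with $\widetilde A_k$ carry the index $k$. Shtraus subspaces. With $\widetilde P_{\mathfrak H}$ the orthogonal projection of $\widetilde{\mathfrak H}$ onto $\mathfrak H$: $T_{\widetilde A}(z)=\{\{\widetilde P_{\mathfrak H}\widetilde f,\widetilde P_{\mathfrak H}\widetilde g\}:\{\widetilde f,\widetilde g\}\in\widetilde A,\ \widetilde g-z\widetilde f\in\mathfrak H\}$ for $z\in\mathbb C$, and $T_{\widetilde A}(\infty)=\{\{\widetilde f,\widetilde P_{\mathfrak H}\widetilde g\}:\{\widetilde f,\widetilde g\}\in\widetilde A,\ \widetilde f\in\mathfrak H\}$. The mappings $\widehat{\mathsf b}_k$. For $\widetilde A\in\mathbb A_{S,\mathsf b}$ let $S_0=\widetilde A\cap\mathfrak H^2$. It is a closed symmetric extension of $S$ with equal defect numbers $d_0$, $0\le d_0\le d$, and $\widehat S$ has the same defect numbers $d_0$. If $d_0>0$, fix (depending only on $S_0$) a boundary mapping for $S_0$ of the form $\mathsf b_0=\mathsf B_0\mathsf b|_{S_0^*}:S_0^*\to\mathbb C^{2d_0}$ with Gram matrix $\mathsf Q_0=(\mathsf B_0\mathsf Q^{-1}\mathsf B_0^* )^{-1}$, where $\mathsf B_0$ is a $2d_0\times 2d$ matrix of rank $2d_0$ with $\mathsf B\mathsf Q^{-1}\mathsf B_0^*=0$ for a full-rank $(d-d_0)\times 2d$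 matrix $\mathsf B$ satisfying $S_0^*=\{\{f,g\}\in S^*:\mathsf B\mathsf b(\{f,g\})=0\}$ (if $d_0=d$ then $S_0=S$ and $\mathsf B_0=\mathsf I_{2d}$, $\mathsf b_0=\mathsf b$, $\mathsf Q_0=\mathsf Q$). Then $\widehat{\mathsf b}:\widehat S^*\to\mathbb C^{2d_0}$ denotes the unique boundary mapping for $\widehat S$ with Gram matrix $-\mathsf Q_0$ such that $$\widetilde A=\Bigl\{\Bigl\{\begin{bmatrix}f\\\widehat f\end{bmatrix},\begin{bmatrix}g\\\widehat g\end{bmatrix}\Bigr\}:\{f,g\}\in S_0^*,\ \{\widehat f,\widehat g\}\in\widehat S^*,\ \mathsf b_0(\{f,g\})+\widehat{\mathsf b}(\{\widehat f,\widehat g\})=0\Bigr\}.$$ In (iii), $\widehat{\mathsf b}_1$ and $\widehat{\mathsf b}_2$ are formed with the same $\mathsf b_0$, since $\widetilde A_1\cap\mathfrak H^2=\widetilde A_2\cap\mathfrak H^2$. If $d_0=0$, then $\widehat{\mathfrak H}_1=\widehat{\mathfrak H}_2=\{0\}$ and the condition on $\widehat{\mathsf b}_1,\widehat{\mathsf b}_2$ is void. *)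

(* Defs.v *)
From HB Require Import structures.
From mathcomp Require Import all_boot all_order all_algebra.
From mathcomp Require Import sesquilinear spectral complex.
From mathcomp Require Import all_classical all_reals all_analysis.

Set Implicit Arguments.
Unset Strict Implicit.
Unset Printing Implicit Defensive.

Import Order.TTheory GRing.Theory Num.Theory Num.Def.
Import numFieldNormedType.Exports.

Local Open Scope classical_set_scope.
Local Open Scope ring_scope.
Local Open Scope complex_scope.
Local Open Scope sesquilinear_scope.

(* A Krein space is a Banach space with a Hermitian form (linear in the first
   argument) having a fundamental symmetry J such that [Jx, x] is the square of
   a Hilbert norm equivalent to the given norm.  The Hilbert norms of any two
   fundamental symmetries are equivalent, so the topology, which is all that is
   used of the norm, is determined by the form. *)
HB.mixin Record CompleteNormedModule_isKrein (R : realType) V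
    of CompleteNormedModule R[i] V := {
  krein_form : {hermitian_sym V for @conjC R[i]} ;
  krein_axiom : exists J : {linear V -> V},
    [/\ forall x, J (J x) = x,
        forall x y, krein_form (J x) y = krein_form x (J y) &
        exists c D : R[i], [/\ 0 < c, 0 < D &
          forall x, c * `|x| ^+ 2 <= krein_form (J x) x <= D * `|x| ^+ 2]]
}.

#[short(type="kreinType")]
HB.structure Definition Krein (R : realType) :=
  {V of CompleteNormedModule R[i] V & CompleteNormedModule_isKrein R V}.

Notation "''[' x , y ]" := (krein_form x y) : ring_scope.

Section prod_complete.
Context {K : numFieldType} (U V : completeNormedModType K).

HB.instance Definition _ := Pointed.on (U * V)%type.

Lemma prod_cauchy_cvg (F : set_system (U * V)%type) :
  ProperFilter F -> cauchy F -> cvg F.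
Proof.
move=> FF Fc.
have c1 : cauchy (fst @ F).
  apply/cauchy_ballP => e e0.
  have /cauchy_ballP/(_ e e0)[[A B] /= [FA FB] AB] := Fc.
  exists (fst @` A, fst @` B) => /=.
    by split; [apply: filterS FA | apply: filterS FB] => x ?; exists x.
  by case=> _ _ /= [[x Ax <-] [y By <-]]; have [] := AB (x, y) (conj Ax By).
have c2 : cauchy (snd @ F).
  apply/cauchy_ballP => e e0.
  have /cauchy_ballP/(_ e e0)[[A B] /= [FA FB] AB] := Fc.
  exists (snd @` A, snd @` B) => /=.
    by split; [apply: filterS FA | apply: filterS FB] => x ?; exists x.
  by case=> _ _ /= [[x Ax <-] [y By <-]]; have [] := AB (x, y) (conj Ax By).
have Fa : cvg (fst @ F) by exact: cauchy_cvg.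
have Fb : cvg (snd @ F) by exact: cauchy_cvg.
apply/cvg_ex; exists (lim (fst @ F), lim (snd @ F)).
have : (fun p : U * V => (p.1, p.2)) @ F --> (lim (fst @ F), lim (snd @ F)).
  exact: cvg_pair.
by under eq_fun do rewrite -surjective_pairing.
Qed.

HB.instance Definition _ :=
  Uniform_isComplete.Build (U * V)%type prod_cauchy_cvg.

End prod_complete.

Section prod_krein.
Context {R : realType} (U V : kreinType R).

(* The form of the orthogonal direct sum of U and V. *)
Definition osum_form (p q : U * V) : R[i] := '[p.1, q.1] + '[p.2, q.2].

Lemma osum_form_bilinear :
  bilinear_for ( *%R : R[i] -> R[i] -> R[i]) (@conjC R[i] \; *%R) osum_form.
Proof.
split => [q a x y | p a x y]; rewrite /osum_form /=.
- by rewrite !linearPl mulrDr addrACA.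
- by rewrite !linearPr /= mulrDr addrACA.
Qed.

HB.instance Definition _ := bilinear_isBilinear.Build R[i] (U * V)%type
  (U * V)%type R[i] *%R (@conjC R[i] \; *%R) osum_form osum_form_bilinear.

Lemma osum_form_hermitian p q :
  osum_form p q = (-1) ^+ false * (osum_form q p)^*%R.
Proof.
by rewrite /osum_form (hermitian_subproof p.1) (hermitian_subproof p.2)
  !expr0 !mul1r rmorphD.
Qed.

HB.instance Definition _ := isHermitianSesquilinear.Build R[i] (U * V)%type
  false (@conjC R[i]) osum_form osum_form_hermitian.

Lemma osum_form_krein : exists J : {linear (U * V)%type -> (U * V)%type},
  [/\ forall x, J (J x) = x,
      forall x y, osum_form (J x) y = osum_form x (J y) &
      exists c D : R[i], [/\ 0 < c, 0 < D &
        forall x, c * `|x| ^+ 2 <= osum_form (J x) x <= D * `|x| ^+ 2]].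
Proof.
have [J1 [J1K J1s [c1 [D1 [c10 D10 h1]]]]] := @krein_axiom R U.
have [J2 [J2K J2s [c2 [D2 [c20 D20 h2]]]]] := @krein_axiom R V.
pose J (p : U * V) : U * V := (J1 p.1, J2 p.2).
have Jlin : linear J by move=> a x y; rewrite /J /= !linearP.
pose J' := GRing.isLinear.Build _ _ _ _ _ Jlin.
pose JL : {linear (U * V)%type -> (U * V)%type} := HB.pack J J'.
exists JL; split => [[x y]|[x y] [x' y']|].
- by rewrite /= /J /= J1K J2K.
- by rewrite /osum_form /= J1s J2s.
have r12 : (c1 >=< c2)%O by apply: real_comparable; exact: gtr0_real.
exists (Num.min c1 c2), (D1 + D2); split.
- by rewrite /Num.min; case: ifP.
- exact: addr_gt0.
have c_1 : Num.min c1 c2 <= c1 by rewrite comparable_ge_min ?lexx.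
have c_2 : Num.min c1 c2 <= c2 by rewrite comparable_ge_min ?lexx ?orbT.
move=> [x y]; have /andP[a1 b1] := h1 x; have /andP[a2 b2] := h2 y.
have i1 : 0 <= '[J1 x, x].
  by apply: le_trans a1; rewrite mulr_ge0 ?exprn_ge0 ?normr_ge0 //; exact: ltW.
have i2 : 0 <= '[J2 y, y].
  by apply: le_trans a2; rewrite mulr_ge0 ?exprn_ge0 ?normr_ge0 //; exact: ltW.
have nE : `|(x, y)| = Num.max `|x| `|y| :> R[i] by [].
rewrite /osum_form /= nE; apply/andP; split.
- rewrite /Num.max; case: ifP => _.
  + apply: le_trans (_ : c2 * `|y| ^+ 2 <= _).
      by rewrite ler_wpM2r ?exprn_ge0 ?normr_ge0.
    by apply: le_trans a2 _; rewrite lerDr.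
  + apply: le_trans (_ : c1 * `|x| ^+ 2 <= _).
      by rewrite ler_wpM2r ?exprn_ge0 ?normr_ge0.
    by apply: le_trans a1 _; rewrite lerDl.
- have n12 : (`|x| >=< `|y|)%O by apply: real_comparable; exact: normr_real.
  have m1 : `|x| <= Num.max `|x| `|y| by rewrite comparable_le_max ?lexx.
  have m2 : `|y| <= Num.max `|x| `|y| by rewrite comparable_le_max ?lexx ?orbT.
  have m0 : 0 <= Num.max `|x| `|y| by apply: le_trans m1.
  rewrite mulrDl lerD //.
  + apply: le_trans b1 _; apply: ler_wpM2l; first exact: ltW.
    by rewrite lerXn2r ?nnegrE ?normr_ge0.
  + apply: le_trans b2 _; apply: ler_wpM2l; first exact: ltW.
    by rewrite lerXn2r ?nnegrE ?normr_ge0.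
Qed.

HB.instance Definition _ := CompleteNormedModule_isKrein.Build R
  (U * V)%type osum_form_krein.

End prod_krein.

Section linear_relations.
Context {R : realType} {V : kreinType R}.
Implicit Types (A S : set (V * V)) (p q : V * V).

Definition linear_relation A : Prop :=
  A 0 /\ forall (a : R[i]) p q, A p -> A q -> A (a *: p + q).

Definition adjoint A : set (V * V) :=
  [set p | forall q, A q -> '[q.2, p.1] = '[q.1, p.2]].

Definition symmetric_relation A : Prop := A `<=` adjoint A.

Definition self_adjoint A : Prop := A = adjoint A.

Definition is_operator A : Prop := forall g, A (0, g) -> g = 0.

Definition has_no_eigenvalue A : Prop :=
  forall (z : R[i]) f, A (f, z *: f) -> f = 0.

Definition boundary_form p q : R[i] := 'i * ('[p.1, q.2] - '[p.2, q.1]).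

Definition basis_modulo (U S : set (V * V)) n (e : 'I_n -> V * V) : Prop :=
  [/\ forall i, U (e i),
      forall p, U p -> exists c : 'I_n -> R[i], S (p - \sum_i c i *: e i) &
      forall c : 'I_n -> R[i], S (\sum_i c i *: e i) -> forall i, c i = 0].

(* S has equal finite defect numbers d: the classes modulo S of some e_1, ...,
   e_2d form a basis of S^* / S in which the boundary form has the matrix
   diag(I_d, -I_d), so that it has d positive and d negative squares. *)
Definition defect_numbers S d : Prop :=
  exists e : 'I_(2 * d) -> V * V,
    basis_modulo (adjoint S) S e /\
    forall i j, boundary_form (e i) (e j) =
                if i == j then (-1) ^+ (d <= i)%N else 0.

(* A map on S^* is represented by a total function whose values outside S^*
   are irrelevant. *)
Definition boundary_mapping S n (b : V * V -> 'cV[R[i]]_n) : Prop :=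
  [/\ forall a p q, adjoint S p -> adjoint S q ->
        b (a *: p + q) = a *: b p + b q,
      forall v, exists2 p, adjoint S p & b p = v &
      [set p | adjoint S p /\ b p = 0] = S].

Definition gram_matrix S n (b : V * V -> 'cV[R[i]]_n) (Q : 'M[R[i]]_n) : Prop :=
  [/\ Q \in unitmx, Q^t* = Q &
      forall p q, adjoint S p -> adjoint S q ->
        boundary_form p q = ((b q)^t* *m Q *m b p) 0 0].

End linear_relations.

Definition finite_dimensional (K : fieldType) (V : lmodType K) : Prop :=
  exists n (e : 'I_n -> V), forall x, exists c : 'I_n -> K,
    x = \sum_i c i *: e i.

Definition krein_isomorphism (R : realType) (U V : kreinType R)
    (F : {linear U -> V}) : Prop :=
  bijective F /\ forall x y, '[F x, F y] = '[x, y].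

Definition graph (U V : Type) (F : U -> V) : set (U * V) :=
  range (fun x => (x, F x)).

(* The Krein space containing H as a Krein subspace is H * K, where K is the
   orthogonal complement of H; an element (f, k) stands for f + k. *)
Section extensions.
Context {R : realType} {H K : kreinType R}.
Implicit Type A : set ((H * K) * (H * K)).

Definition restr_H A : set (H * H) := [set p | A ((p.1, 0), (p.2, 0))].

Definition restr_K A : set (K * K) := [set p | A ((0, p.1), (0, p.2))].

Definition class_A (S : set (H * H)) A : Prop :=
  [/\ self_adjoint A,
      S `<=` restr_H A,
      finite_dimensional K,
      is_operator (restr_K A) &
      has_no_eigenvalue (restr_K A)].

Definition shtraus A (z : R[i]) : set (H * H) :=
  [set p | exists f g : H * K,
     [/\ A (f, g), (g - z *: f).2 = 0 & p = (f.1, g.1)]].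

Definition shtraus_infty A : set (H * H) :=
  [set p | exists f g : H * K, [/\ A (f, g), f.2 = 0 & p = (f.1, g.1)]].

Definition hat_boundary_mapping A n (b0 : H * H -> 'cV[R[i]]_n)
    (Q0 : 'M[R[i]]_n) (bh : K * K -> 'cV[R[i]]_n) : Prop :=
  [/\ boundary_mapping (restr_K A) bh,
      gram_matrix (restr_K A) bh (- Q0) &
      A = [set p | [/\ adjoint (restr_H A) (p.1.1, p.2.1),
                       adjoint (restr_K A) (p.1.2, p.2.2) &
                       b0 (p.1.1, p.2.1) + bh (p.1.2, p.2.2) = 0]]].

End extensions.

(* The conditions on B0 and B alone do not make B0 Q^-1 B0^* invertible; this,
   and that b0 = B0 b is a boundary mapping for S0 with Gram matrix Q0, are
   required separately. *)
Section reduced_boundary_mapping.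
Context {R : realType} {H : kreinType R} {d : nat}.
Variables (b : H * H -> 'cV[R[i]]_(2 * d)) (Q : 'M[R[i]]_(2 * d)).
Variables (d0 : nat) (B0 : 'M[R[i]]_(2 * d0, 2 * d)).

Definition reduced_map (p : H * H) : 'cV[R[i]]_(2 * d0) := B0 *m b p.

Definition reduced_gram : 'M[R[i]]_(2 * d0) :=
  invmx (B0 *m invmx Q *m B0^t*).

Definition reduced_boundary_mapping (S S0 : set (H * H)) : Prop :=
  [/\ \rank B0 = (2 * d0)%N,
      exists B : 'M[R[i]]_(d - d0, 2 * d),
        [/\ \rank B = (d - d0)%N,
            adjoint S0 = [set p | adjoint S p /\ B *m b p = 0] &
            B *m invmx Q *m B0^t* = 0],
      boundary_mapping S0 reduced_map &
      gram_matrix S0 reduced_map reduced_gram].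

End reduced_boundary_mapping.

(* The operator I (+) F from H (+) K1 to H (+) K2. *)
Definition id_osum (R : realType) (H K1 K2 : kreinType R) (F : K1 -> K2)
    (x : H * K1) : H * K2 := (x.1, F x.2).

Definition equivalent_extensions (R : realType) (H K1 K2 : kreinType R)
    (A1 : set ((H * K1) * (H * K1))) (A2 : set ((H * K2) * (H * K2))) : Prop :=
  exists Psi : {linear K1 -> K2},
    krein_isomorphism Psi /\
    (graph (id_osum (H := H) Psi) \; A1 =
     A2 \; graph (id_osum (H := H) Psi))%relation.

(* Main.v *)
(* If [A1] contains [p + {f, z f}] and [q + {g, w g}], with [p], [q] in [H^2] and
   the other summands in [K1^2], then symmetry of [A1] gives
   [(conj w - z) [f, g]] in terms of [p] and [q] alone.  So if the Shtraus
   subspaces of [A1] and [A2] agree, matching [f] in [K1] with [f'] in [K2]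
   whenever [p + {f, z f}] is in [A1] and [p + {f', z f'}] is in [A2] for some
   [p] and some [z] in the upper half plane preserves inner products.  As the
   operator [S^ = A /\ K^2] has no eigenvalues, the elements [{f, z f}] of its
   adjoint, for infinitely many [z], span the whole adjoint; hence the matching
   extends to an isomorphism, and it carries [A1] onto [A2].  Statement (iii) is
   (ii) rewritten in coordinates: by self-adjointness [A] projects onto both
   [S0^*] and [S^^*], and the boundary mapping of [S^] sends the [K]-part of an
   element of [A] to minus the [b0]-value of its [H]-part. *)

Require Import Defs.
From HB Require Import structures.
From mathcomp Require Import all_boot all_order all_algebra.
From mathcomp Require Import sesquilinear spectral complex.
From mathcomp Require Import all_classical all_reals all_analysis.

Set Implicit Arguments.
Unset Strict Implicit.
Unset Printing Implicit Defensive.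

Import Order.TTheory GRing.Theory Num.Theory Num.Def.
Import numFieldNormedType.Exports.

Local Open Scope classical_set_scope.
Local Open Scope ring_scope.
Local Open Scope complex_scope.
Local Open Scope sesquilinear_scope.

(** * Linear algebra in finite dimension: coordinates, eigenvectors, duality *)

Definition linear_subspace (F : fieldType) (V : lmodType F) (U : set V) : Prop :=
  U 0 /\ forall a x y, U x -> U y -> U (a *: x + y).

Section subspace_theory.
Context {F : fieldType} {V : lmodType F}.
Implicit Types (U : set V) (x y : V).

Lemma subspaceD U x y : linear_subspace U -> U x -> U y -> U (x + y).
Proof. by move=> [_ UP] Ux Uy; rewrite -[x]scale1r; exact: UP. Qed.

Lemma subspaceZ U a x : linear_subspace U -> U x -> U (a *: x).
Proof. by move=> [U0 UP] Ux; rewrite -[_ *: _]addr0; exact: UP. Qed.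

Lemma subspaceB U x y : linear_subspace U -> U x -> U y -> U (x - y).
Proof.
move=> sU Ux Uy; rewrite -scaleN1r; apply: subspaceD => //.
exact: subspaceZ.
Qed.

Lemma subspace_sum U n (c : 'I_n -> F) (e : 'I_n -> V) :
  linear_subspace U -> (forall i, U (e i)) -> U (\sum_i c i *: e i).
Proof.
move=> sU Ue; apply: big_ind => [|x y|i _].
- by case: sU.
- exact: subspaceD.
- exact: subspaceZ.
Qed.

End subspace_theory.

(** [B] has maximal rank among the matrices whose row space lies in [W]; appending a vector of [W]
    cannot raise that rank, so the vector was already in the row space. *)
Lemma row_subspace (F : fieldType) n (W : set 'rV[F]_n) :
  linear_subspace W -> exists B : 'M[F]_n, forall x, W x <-> (x <= B)%MS.
Proof.
move=> sW.
pose P r := `[< exists B : 'M[F]_n,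
  (forall x, (x <= B)%MS -> W x) /\ \rank B = r >].
have P0 : exists r, P r.
  exists 0%N; apply/asboolP; exists 0; split; last exact: mxrank0.
  by move=> x; rewrite submx0 => /eqP ->; case: sW.
have Pn r : P r -> (r <= n)%N.
  by move=> /asboolP [B [_ <-]]; exact: rank_leq_row.
case: (ex_maxnP P0 Pn) => r /asboolP [B [BW Br]] rmax.
exists B => x; split => [Wx|]; last exact: BW.
have PBx : P (\rank (B + x)%MS).
  apply/asboolP; exists (B + x)%MS; split=> // y /sub_addsmxP [[u v] ->].
  apply: subspaceD => //; first by apply: BW; exact: submxMl.
  by rewrite [v]mx11_scalar mul_scalar_mx; exact: subspaceZ.
have eqB : (B == B + x)%MS.
  by rewrite -(geq_leqif (mxrank_leqif_eq (addsmxSl B x))) Br; exact: rmax.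
by rewrite (eqmxP eqB) addsmxSr.
Qed.

(** It suffices to test [x] on the columns of [cokermx B], which lie in the kernel of [B]. *)
Lemma submx_kernel (F : fieldType) m n (x : 'rV[F]_n) (B : 'M[F]_(m, n)) :
  (forall c : 'cV[F]_n, B *m c = 0 -> x *m c = 0) -> (x <= B)%MS.
Proof.
move=> Bx; rewrite submxE; have := mulmx_coker B; move: (cokermx B) => K BK.
apply/eqP/matrixP => i j; rewrite (ord1 i); have := Bx (col j K).
by rewrite colE !mulmxA BK mul0mx -colE => /(_ erefl)/matrixP/(_ 0 0); rewrite !mxE.
Qed.

Section finite_dimensional_spaces.
Context {F : fieldType} {V : lmodType F}.
Implicit Types (U : set V).

Definition lincomb n (e : 'I_n -> V) (c : 'rV[F]_n) : V := \sum_i c 0 i *: e i.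

Lemma lincomb_linear n (e : 'I_n -> V) a x y :
  lincomb e (a *: x + y) = a *: lincomb e x + lincomb e y.
Proof.
rewrite /lincomb scaler_sumr -big_split; apply: eq_bigr => i _ /=.
by rewrite !mxE scalerDl scalerA.
Qed.

Lemma lincomb0 n (e : 'I_n -> V) : lincomb e 0 = 0.
Proof. by rewrite /lincomb big1 // => i _; rewrite mxE scale0r. Qed.

Lemma lincomb_mulmx m n (e : 'I_n -> V) (c : 'rV[F]_m) (B : 'M[F]_(m, n)) :
  lincomb e (c *m B) = lincomb (fun i => lincomb e (row i B)) c.
Proof.
rewrite /lincomb; under [RHS]eq_bigr do rewrite scaler_sumr.
rewrite exchange_big /=; apply: eq_bigr => j _; rewrite mxE scaler_suml.
by apply: eq_bigr => i _; rewrite scalerA mxE.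
Qed.

Lemma lincomb_pair n (e f : 'I_n -> V) (c : 'rV[F]_n) :
  \sum_i c 0 i *: (e i, f i) = (lincomb e c, lincomb f c).
Proof. by apply: (big_ind3 (fun p x y => p = (x, y))) => // _ x y _ x' y' -> ->. Qed.

Lemma finite_dimensional_lincomb : finite_dimensional V ->
  exists n (e : 'I_n -> V), forall x, exists c, x = lincomb e c.
Proof.
move=> [n [e eP]]; exists n, e => x; have [c ->] := eP x.
exists (\row_i c i); by apply: eq_bigr => i _; rewrite mxE.
Qed.

Lemma subspace_coordinates U n (e : 'I_n -> V) : linear_subspace U ->
  exists B : 'M[F]_n, forall c, U (lincomb e c) <-> (c <= B)%MS.
Proof.
move=> sU; apply: (@row_subspace F n [set c | U (lincomb e c)]).
split=> /= [|a x y Ux Uy]; first by rewrite lincomb0; case: sU.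
by rewrite lincomb_linear; apply sU.
Qed.

(** The spanning family [e] may be dependent. With [B] the coordinates of vectors of [U] and [C]
    those of zero, a basis of a complement of [C] in [B] gives independent vectors spanning [U]. *)
Lemma subspace_basis U : finite_dimensional V -> linear_subspace U ->
  exists r (u : 'I_r -> V), [/\ forall i, U (u i),
    forall x, U x -> exists c, x = lincomb u c &
    forall c, lincomb u c = 0 -> c = 0].
Proof.
move=> /finite_dimensional_lincomb [n [e eP]] sU.
have [B BP] := subspace_coordinates e sU.
have s0 : linear_subspace [set (0 : V)].
  by split=> // a x y -> ->; rewrite scaler0 addr0.
have [C CP] := subspace_coordinates e s0.
have sCB : (C <= B)%MS.
  apply/row_subP => i; apply/BP; have /CP -> : (row i C <= C)%MS by apply row_sub.
  by case: sU.
pose D := row_base (B :\: C)%MS.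
exists _, (fun i => lincomb e (row i D)); split.
- move=> i; apply/BP; apply: submx_trans (row_sub _ _) _.
  by rewrite eq_row_base diffmxSl.
- move=> x Ux; have [c xE] := eP x; have cB : (c <= B)%MS by apply/BP; rewrite -xE.
  have : (c <= B :\: C + B :&: C)%MS by rewrite addsmx_diff_cap_eq.
  move=> /sub_addsmxP [[u v] /= cE].
  have /submxP [w wE] : (u *m (B :\: C)%MS <= D)%MS.
    by rewrite eq_row_base submxMl.
  exists w; rewrite -lincomb_mulmx -wE xE cE -[u *m _]scale1r lincomb_linear.
  suff -> : lincomb e (v *m (B :&: C)%MS) = 0 by rewrite addr0 !scale1r.
  by apply/CP; apply: submx_trans (submxMl _ _) _; exact: capmxSr.
- move=> c; rewrite -lincomb_mulmx => /CP cC.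
  have : (c *m D <= (B :\: C) :&: C)%MS.
    by rewrite sub_capmx cC andbT -(eq_row_base (B :\: C)%MS) submxMl.
  rewrite capmx_diff submx0 => /eqP cD.
  by apply/(row_free_injr (row_base_free (B :\: C)%MS)); rewrite /= mul0mx.
Qed.

End finite_dimensional_spaces.

(** [T] may be multivalued, so one value in [U] is chosen for each basis vector; the resulting
    square matrix has an eigenvector over a closed field. *)
Lemma subspace_eigenvector (C : numClosedFieldType) (V : lmodType C)
    (U : set V) (T : set (V * V)) (x : V) :
    finite_dimensional V -> linear_subspace U -> linear_subspace T ->
    (forall v, U v -> exists2 f, U f & T (v, f)) -> U x -> x != 0 ->
  exists v a, v != 0 /\ T (v, a *: v).
Proof.
move=> fV sU sT UT Ux x0; have [r [u [Uu uP u0]]] := subspace_basis fV sU.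
have /choice [m mP] : forall i, exists m : 'rV_r, T (u i, lincomb u m).
  move=> i; have [f Uf Tf] := UT _ (Uu i); have [c cE] := uP _ Uf.
  by exists c; rewrite -cE.
have r0 : (0 < r)%N.
  rewrite lt0n; apply: contra x0 => /eqP r0; have [c ->] := uP _ Ux.
  by apply/eqP; rewrite /lincomb big1 // => -[i ir]; exfalso; rewrite r0 in ir.
pose M := \matrix_i m i.
have [a /eigenvalueP [c cM c0]] := eigenvalue_closed M r0.
exists (lincomb u c), a; split; first by apply: contra c0 => /eqP /u0 ->.
rewrite -[a *: _]addr0 -(lincomb0 u) -lincomb_linear addr0 -cM lincomb_mulmx.
have -> : (fun i => lincomb u (row i M)) = (fun i => lincomb u (m i)).
  by apply/funext => i; rewrite rowK.
by rewrite -lincomb_pair; exact: subspace_sum.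
Qed.

(** In terms of the Gram matrix [G] of a spanning family, the hypothesis says that [cx *m G]
    annihilates the kernel of [B *m G], hence lies in its row space. Nondegeneracy then removes [G],
    which is singular when the family is dependent. *)
Lemma double_orthogonal (C : numClosedFieldType) (V : lmodType C)
    (f : V -> V -> C) (U : set V) (x : V) :
    finite_dimensional V ->
    (forall a x y z, f (a *: x + y) z = a * f x z + f y z) ->
    (forall a x y z, f z (a *: x + y) = conjC a * f z x + f z y) ->
    (forall x, (forall y, f x y = 0) -> x = 0) ->
    linear_subspace U -> (forall y, (forall u, U u -> f u y = 0) -> f x y = 0) ->
  U x.
Proof.
move=> /finite_dimensional_lincomb [n [e eP]] fl fr f0 sU Ux.
have [B BP] := subspace_coordinates e sU.
have f0l z : f 0 z = 0.
  by have := fl 1 0 0 z; rewrite scaler0 addr0 mul1r -[LHS]addr0 => /addrI.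
have f0r z : f z 0 = 0.
  by have := fr 1 0 0 z; rewrite scaler0 addr0 conjC1 mul1r -[LHS]addr0 => /addrI.
have flS c y : f (lincomb e c) y = \sum_i c 0 i * f (e i) y.
  rewrite /lincomb; apply: (big_ind2 (fun u v => f u y = v)) => //.
  - by move=> u a v b <- <-; rewrite -[u]scale1r fl mul1r scale1r.
  - by move=> i _; rewrite -[_ *: _]addr0 fl f0l addr0.
have frS c y : f y (lincomb e c) = \sum_i f y (e i) * conjC (c 0 i).
  rewrite /lincomb; apply: (big_ind2 (fun u v => f y u = v)) => //.
  - by move=> u a v b <- <-; rewrite -[u]scale1r fr conjC1 mul1r scale1r.
  - by move=> i _; rewrite -[_ *: _]addr0 fr f0r addr0 mulrC.
pose G := \matrix_(i, j) f (e i) (e j).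
(* Conjugated coordinates turn the sesquilinear form into the plain matrix product of [fG]. *)
pose vec (c : 'cV[C]_n) := lincomb e (\row_i conjC (c i 0)).
have fG c c' : f (lincomb e c) (vec c') = (c *m (G *m c')) 0 0.
  rewrite flS mxE; apply: eq_bigr => i _; congr (_ * _).
  rewrite frS mxE; apply: eq_bigr => j _; by rewrite !mxE conjCK.
have [cx xE] := eP x.
have /submxP [a aE] : (cx *m G <= B *m G)%MS.
  apply: submx_kernel => c; rewrite -!mulmxA => Bc.
  apply/matrixP => i j; rewrite (ord1 i) (ord1 j) -fG -xE Ux ?mxE // => u.
  have [cu -> /BP /submxP [w ->]] := eP u.
  by rewrite fG -mulmxA Bc mulmx0 mxE.
have /eqP : lincomb e (cx - a *m B) = 0.
  apply: f0 => y; have [c ->] := eP y.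
  have -> : lincomb e c = vec (\col_i conjC (c 0 i)).
    by congr lincomb; apply/rowP => i; rewrite !mxE conjCK.
  by rewrite fG mulmxBl !mulmxA aE mulmxA subrr mxE.
rewrite -scaleN1r addrC lincomb_linear scaleN1r addrC subr_eq0 -xE => /eqP ->.
by apply/BP; exact: submxMl.
Qed.

(** * Resolvents of an operator without eigenvalues *)

Section resolvents.
Context {C : numClosedFieldType} {V : lmodType C}.
Variables (S : set (V * V)) (z : nat -> C).
Hypotheses (V_fin : finite_dimensional V) (S_sub : linear_subspace S)
  (S_op : forall g, S (0, g) -> g = 0)
  (S_eigen : forall a f, S (f, a *: f) -> f = 0)
  (z_inj : injective z).

Lemma z_sub_neq0 j k : j != k -> z j - z k != 0.
Proof. by apply: contraNneq => /subr0_eq /z_inj ->. Qed.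

(** The resolvent identity: the difference quotient of solutions at [z j] and [z k] solves the
    equation at [z j] whose right-hand side is the solution at [z k]. *)
Lemma resolvent_vector j k (f v x : V) : j != k ->
  (z j - z k)^-1 *: ((v + z j *: f) - (v + z k *: x)) =
  x + z j *: ((z j - z k)^-1 *: (f - x)).
Proof.
move=> /z_sub_neq0 zjk; apply: (scalerI zjk).
rewrite scalerKV // scalerDr !scalerA mulrAC divff // mul1r.
by rewrite opprD addrACA subrr add0r scalerBl scalerBr [RHS]addrC subrKA.
Qed.

(* The vectors lying in [ran (S - z k)] for all large [k] form a subspace mapped
   into itself by a suitable [(S - z j)^-1]; were it nonzero, an eigenvector
   of this map would be an eigenvector of [S]. *)
Lemma ran_eventually0 v N :
  (forall k, (N <= k)%N -> exists f, S (f, v + z k *: f)) -> v = 0.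
Proof.
pose U : set V := [set v | exists N, forall k, (N <= k)%N ->
  exists f, S (f, v + z k *: f)].
have sU : linear_subspace U.
  split=> [|a x y [M Mx] [L Ly]].
    by exists 0%N => k _; exists 0; rewrite scaler0 addr0; case: S_sub.
  exists (maxn M L) => k; rewrite geq_max => /andP [/Mx [f Sf] /Ly [g Sg]].
  exists (a *: f + g); have := proj2 S_sub a _ _ Sf Sg.
  by congr S; congr pair => /=; rewrite !scalerDr !scalerA mulrC addrACA.
move=> Nv; apply/eqP/negPn/negP => v0; have Uv : U v by exists N.
have [r [u [Uu uP _]]] := subspace_basis V_fin sU.
have [M MP] := choice Uu.
(* An index past the thresholds of all basis vectors, so that [z w] serves all of [U]. *)
pose w := (\max_i M i)%N.
have Uw x : U x -> exists f, S (f, x + z w *: f).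
  move=> /uP [c ->].
  have /choice [f fP] i : exists f, S (f, u i + z w *: f).
    by apply: (MP i); exact: leq_bigmax.
  exists (lincomb f c).
  have -> : (lincomb f c, lincomb u c + z w *: lincomb f c) =
      \sum_i c 0 i *: (f i, u i + z w *: f i).
    rewrite lincomb_pair; congr pair; rewrite /lincomb scaler_sumr -big_split.
    by apply: eq_bigr => i _; rewrite /= scalerDr !scalerA mulrC.
  exact: subspace_sum.
pose T : set (V * V) := [set p | S (p.2, p.1 + z w *: p.2)].
have sT : linear_subspace T.
  split=> [|a p q Sp Sq]; first by rewrite /T /= scaler0 addr0; case: S_sub.
  have := proj2 S_sub a _ _ Sp Sq.
  by congr S; congr pair => /=; rewrite !scalerDr !scalerA mulrC addrACA.
have UT x : U x -> exists2 f, U f & T (x, f).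
  move=> Ux; have [f Sf] := Uw x Ux; exists f => //.
  (* The threshold exceeds [w] to keep [z k - z w] nonzero in the difference quotient. *)
  have [L Lx] := Ux; exists (maxn L w.+1) => k.
  rewrite geq_max => /andP [/Lx [g Sg] wk].
  exists ((z k - z w)^-1 *: (g - f)); rewrite -(@resolvent_vector k w g x f) ?gtn_eqF //.
  exact: subspaceZ S_sub (subspaceB S_sub Sg Sf).
have [x [a [x0 Tx]]] := subspace_eigenvector V_fin sU sT UT Uv v0.
(* [T] inverts [S - z w]: [a = 0] would put [x] in the multivalued part of [S], and any other [a]
   gives [S] the eigenvalue [a^-1 + z w]. *)
case: (eqVneq a 0) => [a0|a0].
  by move: Tx; rewrite a0 /T /= !scale0r scaler0 addr0 => /S_op /eqP; exact/negP.
have : S (a *: x, (a^-1 + z w) *: (a *: x)) by rewrite scalerDl scalerK.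
move=> /S_eigen /eqP; rewrite scaler_eq0 (negPf a0) /=; exact/negP.
Qed.

(** Difference quotients of the vectors [f j - h] show that [f 0 - h] lies in the range of [S - z j]
    for every [j >= 1]; hence it vanishes, and the hypothesis at 0 reads [S (h, k)]. *)
Lemma mem_of_resolvents h k :
  (forall j, exists f, S (f, k + z j *: (f - h))) -> S (h, k).
Proof.
move=> /choice [f fP]; suff : f 0%N - h = 0.
  by move=> fh; have := fP 0%N; rewrite fh scaler0 addr0 -(subr0_eq fh).
apply: (@ran_eventually0 _ 1%N) => j j0.
exists ((z j - z 0%N)^-1 *: ((f j - h) - (f 0%N - h))).
rewrite -(@resolvent_vector j 0%N (f j - h) k (f 0%N - h)) ?gtn_eqF // opprB subrKA.
exact: subspaceZ S_sub (subspaceB S_sub (fP j) (fP 0%N)).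
Qed.

End resolvents.

(** * Duality for linear relations in a Krein space *)

Section krein_relations.
Context {R : realType} {V : kreinType R}.
Implicit Types (S A : set (V * V)) (p q r : V * V).

Lemma krein_nondegenerate (x : V) : (forall y, '[x, y] = 0) -> x = 0.
Proof.
move=> x0; have [J [_ Js [c [D [c0 _ JP]]]]] := @krein_axiom R V.
have /andP [+ _] := JP x; rewrite Js x0.
rewrite pmulr_rle0 // => le0; apply/eqP; rewrite -normr_eq0 -sqrf_eq0.
by rewrite eq_le le0 exprn_ge0.
Qed.

Lemma krein_formC (x y : V) : '[x, y] = conjC '[y, x].
Proof. by rewrite (hermitian_subproof x y) expr0 mul1r. Qed.

Lemma krein_formBl (x y z : V) : '[x - y, z] = '[x, z] - '[y, z].
Proof. exact: linearBl. Qed.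

Lemma krein_formBr (x y z : V) : '[z, x - y] = '[z, x] - '[z, y].
Proof. exact: linearBr. Qed.

Lemma krein_formZl a (x z : V) : '[a *: x, z] = a * '[x, z].
Proof. exact: linearZl_LR. Qed.

Lemma krein_formZr a (x z : V) : '[z, a *: x] = conjC a * '[z, x].
Proof. exact: linearZr_LR. Qed.

Lemma krein_form0l (x : V) : '[0, x] = 0.
Proof. exact: linear0l. Qed.

Lemma krein_form0r (x : V) : '[x, 0] = 0.
Proof. exact: linear0r. Qed.

Lemma boundary_formPl a p q r :
  boundary_form (a *: p + q) r = a * boundary_form p r + boundary_form q r.
Proof.
by rewrite /boundary_form /= !linearPl opprD addrACA mulrDr -mulrBr mulrCA.
Qed.

Lemma boundary_formPr a p q r :
  boundary_form r (a *: p + q) =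
    conjC a * boundary_form r p + boundary_form r q.
Proof.
by rewrite /boundary_form /= !linearPr /= opprD addrACA mulrDr -mulrBr mulrCA.
Qed.

Lemma boundary_formC p q : boundary_form p q = conjC (boundary_form q p).
Proof.
rewrite /boundary_form rmorphM rmorphB /= -!krein_formC conjCi mulNr -mulrN.
by rewrite opprB.
Qed.

Lemma boundary_form_nondegenerate p :
  (forall q, boundary_form p q = 0) -> p = 0.
Proof.
have i0 := neq0Ci R[i].
move=> p0; rewrite [p]surjective_pairing; congr pair; apply: krein_nondegenerate => y.
- have /eqP := p0 (0, y); rewrite /boundary_form krein_form0r subr0.
  by rewrite mulf_eq0 (negPf i0) => /eqP.
- have /eqP := p0 (y, 0); rewrite /boundary_form krein_form0r sub0r.
  by rewrite mulf_eq0 (negPf i0) oppr_eq0 => /eqP.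
Qed.

(** Adjoints are orthogonal complements for the nondegenerate boundary form, so double orthogonality
    applies to relations as well. *)
Lemma adjointP S p :
  adjoint S p <-> forall q, S q -> boundary_form q p = 0.
Proof.
split=> pS q /pS; first by rewrite /boundary_form => ->; rewrite subrr mulr0.
by move=> /eqP; rewrite mulf_eq0 (negPf (neq0Ci _)) subr_eq0 => /eqP.
Qed.

Lemma adjoint_subspace S : linear_subspace (adjoint S).
Proof.
split=> [|a p q /adjointP Sp /adjointP Sq].
  by apply/adjointP => q _; rewrite /boundary_form !krein_form0r subrr mulr0.
by apply/adjointP => r Sr; rewrite boundary_formPr Sp // Sq // mulr0 addr0.
Qed.

Hypothesis V_fin : finite_dimensional V.

Lemma finite_dimensional_pair : finite_dimensional (V * V)%type.
Proof.
have [n [e eP]] := finite_dimensional_lincomb V_fin.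
exists (n + n)%N, (fun i : 'I_(n + n) => match fintype.split i with
  | inl j => (e j, 0) | inr j => (0, e j) end) => -[x y].
have [c ->] := eP x; have [c' ->] := eP y.
exists ((row_mx c c') 0); rewrite big_split_ord /=.
under eq_bigr do rewrite row_mxEl (unsplitK (inl _)).
under [X in _ = _ + X]eq_bigr do rewrite row_mxEr (unsplitK (inr _)).
have l0 (d : 'rV[R[i]]_n) : lincomb (fun=> 0 : V) d = 0.
  by rewrite /lincomb big1 // => i _; rewrite scaler0.
by rewrite !lincomb_pair l0 l0; congr pair; rewrite /= ?addr0 ?add0r.
Qed.

Variables (z : nat -> R[i]).
Hypothesis z_inj : injective z.

(** The eigenvectors of the adjoint at [z j] form the orthogonal complement of the range of
    [S - conjC (z j)]. With [p = (h, k)], double orthogonality puts [k - conjC (z j) *: h] into that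
    range for every [j], which forces [p] into [S]. *)
Lemma adjoint_eigenvectors S p :
    linear_subspace S -> is_operator S -> has_no_eigenvalue S ->
    (forall j f, adjoint S (f, z j *: f) -> boundary_form (f, z j *: f) p = 0) ->
  S p.
Proof.
move=> sS oS eS pN; case: p pN => h k pN.
apply: (@mem_of_resolvents _ _ S (fun j => conjC (z j))) => //.
  by move=> j l /(can_inj conjCK) /z_inj.
move=> j; pose W : set V := [set v | exists2 q, S q & v = q.2 - conjC (z j) *: q.1].
have [q Sq qE] : W (k - conjC (z j) *: h).
  apply: (double_orthogonal V_fin (f := fun x y => '[x, y])).
  - by move=> a x y w; rewrite linearPl.
  - by move=> a x y w; rewrite linearPr.
  - exact: krein_nondegenerate.
  - split=> [|a _ _ [q Sq ->] [r Sr ->]].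
      by exists 0; [case: sS | rewrite scaler0 subr0].
    exists (a *: q + r); first exact: (proj2 sS).
    by rewrite /= scalerBr scalerDr !scalerA opprD addrACA mulrC.
  move=> y Wy; have : adjoint S (y, z j *: y).
    move=> q Sq; have := Wy (q.2 - conjC (z j) *: q.1).
    rewrite krein_formBl krein_formZl krein_formZr => Wq; apply: subr0_eq; apply: Wq.
    by exists q.
  move=> /pN /eqP; rewrite /boundary_form mulf_eq0 (negPf (neq0Ci _)) /= => /eqP yp.
  by rewrite krein_formC krein_formBr krein_formZr conjCK -krein_formZl yp conjC0.
exists q.1; rewrite scalerBr addrCA.
have -> : k - conjC (z j) *: h = q.2 - conjC (z j) *: q.1 by [].
by rewrite subrKC -surjective_pairing.
Qed.

(** By [adjoint_eigenvectors] everything orthogonal to [W] lies in [S], hence is orthogonal to the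
    adjoint of [S]; double orthogonality concludes. *)
Lemma adjoint_span S W :
    linear_subspace S -> is_operator S -> has_no_eigenvalue S -> linear_subspace W ->
    (forall j f, adjoint S (f, z j *: f) -> W (f, z j *: f)) ->
  adjoint S `<=` W.
Proof.
move=> sS oS eS sW zW p Sp.
apply: (double_orthogonal finite_dimensional_pair (f := boundary_form)) => //.
- exact: boundary_formPl.
- exact: boundary_formPr.
- exact: boundary_form_nondegenerate.
move=> q Wq; have /adjointP := Sp; rewrite boundary_formC => ->; first exact: conjC0.
by apply: adjoint_eigenvectors => // j f /zW; exact: Wq.
Qed.

(** If [y] is orthogonal to [W], then [(0, y)] is orthogonal to the eigenvectors for the boundary
    form, so it lies in the operator [S] and [y = 0]. *)
Lemma eigenvector_span S (W : set V) :
    linear_subspace S -> is_operator S -> has_no_eigenvalue S -> linear_subspace W ->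
    (forall j f, adjoint S (f, z j *: f) -> W f) ->
  forall x, W x.
Proof.
move=> sS oS eS sW zW x.
apply: (double_orthogonal V_fin (f := fun x y => '[x, y])) => //.
- by move=> a y w t; rewrite linearPl.
- by move=> a y w t; rewrite linearPr.
- exact: krein_nondegenerate.
move=> y Wy; suff -> : y = 0 by rewrite krein_form0r.
apply: (oS); apply: adjoint_eigenvectors => // j f /zW Wf.
by rewrite /boundary_form /= krein_form0r Wy // subrr mulr0.
Qed.

End krein_relations.

(** The span [G] of [E] is still isometric and projects onto both spaces; nondegeneracy makes it
    single-valued in both directions, hence the graph of an isomorphism. *)
Lemma isometry_extension (R : realType) (K1 K2 : kreinType R)
    (E : set (K1 * K2)) :
    (forall x y, E x -> E y -> '[x.1, y.1] = '[x.2, y.2]) ->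
    (forall W : set K1, linear_subspace W -> (forall x, E x -> W x.1) -> forall v, W v) ->
    (forall W : set K2, linear_subspace W -> (forall x, E x -> W x.2) -> forall v, W v) ->
  exists Psi : {linear K1 -> K2},
    krein_isomorphism Psi /\ forall x, E x -> Psi x.1 = x.2.
Proof.
move=> Eiso E1 E2.
pose G : set (K1 * K2) := [set x | forall W, linear_subspace W -> E `<=` W -> W x].
have EG : E `<=` G by move=> x Ex W sW EW; exact: EW.
have sG : linear_subspace G.
  split=> [W [W0 _] _ //|a x y Gx Gy W sW EW].
  exact: (proj2 sW a x y (Gx W sW EW) (Gy W sW EW)).
have Giso x y : G x -> G y -> '[x.1, y.1] = '[x.2, y.2].
  (* The identity passes from [E] to its span one argument at a time. *)
  pose Z (x : K1 * K2) : set (K1 * K2) := [set y | '[x.1, y.1] = '[x.2, y.2]].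
  have sZ u : linear_subspace (Z u).
    split=> [|a v w uv uw]; first by rewrite /Z /= !krein_form0r.
    by rewrite /Z /= !linearPr /= uv uw.
  have Zsym u v : Z u v -> Z v u.
    by move=> uv; rewrite /Z /= krein_formC uv -krein_formC.
  move=> Gx Gy; apply: (Gy (Z x)) => // v Ev; apply: Zsym.
  by apply: (Gx (Z v)) => // w Ew; exact: Eiso.
have [G1 G2] : (forall v, exists w, G (v, w)) /\ (forall w, exists v, G (v, w)).
  split.
    apply: E1 => [|[v w] Evw]; last by exists w; exact: EG.
    split=> [|a v v' [w Gw] [w' Gw']]; first by exists 0; case: sG.
    by exists (a *: w + w'); exact: (proj2 sG a _ _ Gw Gw').
  apply: E2 => [|[v w] Evw]; last by exists v; exact: EG.
  split=> [|a w w' [v Gv] [v' Gv']]; first by exists 0; case: sG.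
  by exists (a *: v + v'); exact: (proj2 sG a _ _ Gv Gv').
have G0r w : G (0, w) -> w = 0.
  move=> Gw; apply: krein_nondegenerate => y; have [x Gx] := G2 y.
  by rewrite -(Giso _ _ Gw Gx) krein_form0l.
have G0l v : G (v, 0) -> v = 0.
  move=> Gv; apply: krein_nondegenerate => x; have [y Gy] := G1 x.
  by rewrite (Giso _ _ Gv Gy) krein_form0l.
have Gfun v w w' : G (v, w) -> G (v, w') -> w = w'.
  move=> Gw Gw'; apply/subr0_eq/G0r.
  by have := subspaceB sG Gw Gw'; congr G; congr pair; rewrite /= subrr.
have Ginj v v' w : G (v, w) -> G (v', w) -> v = v'.
  move=> Gv Gv'; apply/subr0_eq/G0l.
  by have := subspaceB sG Gv Gv'; congr G; congr pair; rewrite /= subrr.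
have [psi psiG] := choice G1; have [phi phiG] := choice G2.
have psi_linear : linear psi.
  by move=> a x y; apply: Gfun (psiG _) (proj2 sG a _ _ (psiG x) (psiG y)).
pose psiL := GRing.isLinear.Build _ _ _ _ _ psi_linear.
pose Psi : {linear K1 -> K2} := HB.pack psi psiL.
exists Psi; split; last by case=> v w /EG; exact: Gfun (psiG v).
split; last by move=> x y; rewrite (Giso _ _ (psiG x) (psiG y)).
exists phi => v; first exact: Ginj (phiG _) (psiG v).
exact: Gfun (psiG _) (phiG v).
Qed.

(** * Self-adjoint relations in an orthogonal sum *)

Definition oplus (U V : Type) (p : U * U) (q : V * V) : (U * V) * (U * V) :=
  ((p.1, q.1), (p.2, q.2)).

Lemma oplus_surjective (U V : Type) (x : (U * V) * (U * V)) :
  x = oplus (x.1.1, x.2.1) (x.1.2, x.2.2).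
Proof. by case: x => [[? ?] [? ?]]. Qed.

Section self_adjoint_extension.
Context {R : realType} {H K : kreinType R}.
Variable A : set ((H * K) * (H * K)).
Hypothesis A_sa : self_adjoint A.
Implicit Types (p : H * H) (q : K * K).

Lemma boundary_form_oplus p q p' q' :
  boundary_form (oplus p q) (oplus p' q') =
    boundary_form p p' + boundary_form q q'.
Proof. by rewrite /boundary_form -mulrDr addrACA -opprD. Qed.

Lemma self_adjoint_subspace : linear_subspace A.
Proof. by rewrite A_sa; exact: adjoint_subspace. Qed.

Lemma self_adjoint_form p q p' q' :
  A (oplus p q) -> A (oplus p' q') ->
  boundary_form p p' = - boundary_form q q'.
Proof.
move=> Apq; rewrite {1}A_sa => /adjointP /(_ _ Apq).
by rewrite boundary_form_oplus => /eqP; rewrite addr_eq0 => /eqP.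
Qed.

Lemma oplusD a p q p' q' : A (oplus p q) -> A (oplus p' q') ->
  A (oplus (a *: p + p') (a *: q + q')).
Proof. exact: (proj2 self_adjoint_subspace a). Qed.

Lemma oplusB p q p' q' : A (oplus p q) -> A (oplus p' q') ->
  A (oplus (p - p') (q - q')).
Proof. exact: (subspaceB self_adjoint_subspace). Qed.

Lemma restr_H_subspace : linear_subspace (restr_H A).
Proof.
split=> [|a p p' Ap Ap']; first by case: self_adjoint_subspace.
by have := @oplusD a p 0 p' 0 Ap Ap'; rewrite (_ : a *: 0 + 0 = 0 :> K * K) ?scaler0 ?addr0.
Qed.

Lemma restr_K_subspace : linear_subspace (restr_K A).
Proof.
split=> [|a q q' Aq Aq']; first by case: self_adjoint_subspace.
by have := @oplusD a 0 q 0 q' Aq Aq'; rewrite (_ : a *: 0 + 0 = 0 :> H * H) ?scaler0 ?addr0.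
Qed.

Lemma adjoint_restr_H p q : A (oplus p q) -> adjoint (restr_H A) p.
Proof.
move=> Apq; apply/adjointP => p' Ap'; rewrite (@self_adjoint_form p' 0 p q Ap' Apq).
by rewrite /boundary_form /= !krein_form0l subrr mulr0 oppr0.
Qed.

Lemma adjoint_restr_K p q : A (oplus p q) -> adjoint (restr_K A) q.
Proof.
move=> Apq; apply/adjointP => q' Aq'; have := @self_adjoint_form 0 q' p q Aq' Apq.
rewrite /boundary_form /= !krein_form0l subrr mulr0.
by move=> /esym /eqP; rewrite oppr_eq0 => /eqP.
Qed.

Lemma shtrausP z p : shtraus A z p <-> exists f, A (oplus p (f, z *: f)).
Proof.
split=> [[[f1 f2] [[g1 g2] [Afg fg ->]]]|[f Af]].
  by exists f2; rewrite -[z *: f2](subr0_eq (fg : g2 - z *: f2 = 0)).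
exists (p.1, f), (p.2, z *: f); split => //; first exact: subrr.
by rewrite -surjective_pairing.
Qed.

Hypothesis K_fin : finite_dimensional K.

(** Let [W] be the projection of [A] to [K^2]. If [r] is orthogonal to [W], then [oplus 0 r] is in
    the adjoint of [A], that is in [A], so [r] is orthogonal to [q]. Thus [q] lies in the double
    orthogonal of [W]. *)
Lemma adjoint_restr_K_lift q : adjoint (restr_K A) q -> exists p, A (oplus p q).
Proof.
move=> Aq; pose W : set (K * K) := [set q | exists p, A (oplus p q)].
change (W q).
apply: (double_orthogonal (finite_dimensional_pair K_fin) (f := boundary_form)).
- exact: boundary_formPl.
- exact: boundary_formPr.
- exact: boundary_form_nondegenerate.
- split=> [|a r r' [p Apr] [p' Apr']].
    by exists 0; case: self_adjoint_subspace.
  by exists (a *: p + p'); exact: oplusD.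
move=> r Wr; rewrite boundary_formC; apply/eqP; rewrite conjC_eq0; apply/eqP.
move/adjointP: Aq; apply; rewrite /restr_K /= A_sa.
apply/adjointP => x Ax; rewrite (oplus_surjective x).
rewrite -[((0, r.1), _)]/(oplus 0 r) boundary_form_oplus Wr; last first.
  by exists (x.1.1, x.2.1); rewrite -oplus_surjective.
by rewrite /boundary_form !krein_form0r subrr mulr0 addr0.
Qed.

End self_adjoint_extension.

Lemma intertwiningP (T U : Type) (F : T -> U) (A : set (T * T))
    (B : set (U * U)) : bijective F ->
  (graph F \; A = B \; graph F)%relation <->
  forall x, A x <-> B (F x.1, F x.2).
Proof.
move=> [G FK GK]; split=> [AB [x y]|AB].
  split=> Axy.
    have : (B \; graph F)%relation (x, F y) by rewrite -AB; exists y => //; exists y.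
    by case=> z [w _ [-> <-]].
  have : (graph F \; A)%relation (x, F y) by rewrite AB; exists (F x) => //; exists x.
  by case=> z Axz [w _ [wz /(can_inj FK) wy]]; rewrite /= -wz wy in Axz.
apply/seteqP; split=> -[x y] /=.
  case=> z /AB /= BFxz [w _ [wz <-]].
  by exists (F x); [exists x | rewrite wz].
case=> z [w _ [wx wz]] Bzy; exists (G y); last by exists (G y); rewrite ?GK.
by apply/AB; rewrite /= GK -wx wz.
Qed.

Lemma equivalent_extensionsP (R : realType) (H K1 K2 : kreinType R)
    (A1 : set ((H * K1) * (H * K1))) (A2 : set ((H * K2) * (H * K2)))
    (Psi : {linear K1 -> K2}) : bijective Psi ->
  (graph (id_osum (H := H) Psi) \; A1 =
     A2 \; graph (id_osum (H := H) Psi))%relation <->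
  forall p q, A1 (oplus p q) <-> A2 (oplus p (Psi q.1, Psi q.2)).
Proof.
move=> [Phi PhiK PsiK].
have bI : bijective (id_osum (H := H) Psi).
  by exists (id_osum Phi) => -[x y]; rewrite /id_osum /= ?PhiK ?PsiK.
split=> [/(intertwiningP _ _ bI) A12 p q|A12]; first exact: A12.
by apply/(intertwiningP _ _ bI) => x; rewrite {1}(oplus_surjective x).
Qed.

(** * Equal Shtraus subspaces and equivalence *)

Section upper_points.
Variable C : numClosedFieldType.

(** Distinct points of the open upper half plane, so that [conjC (z j) - z k] is nonzero even for
    [j = k]. *)
Definition upper_point (j : nat) : C := 'i * j.+1%:R.

Lemma upper_point_inj : injective upper_point.
Proof.
move=> j k /(mulfI (neq0Ci C)) /eqP.
by rewrite eqr_nat => /eqP [].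
Qed.

Lemma upper_point_conj j k : conjC (upper_point j) - upper_point k != 0.
Proof.
rewrite rmorphM /= conjCi conjC_nat mulNr -opprD -mulrDr -natrD oppr_eq0.
by rewrite mulf_neq0 ?neq0Ci // pnatr_eq0.
Qed.

End upper_points.

Lemma boundary_form_eigenvectors (R : realType) (K : kreinType R) (a c : R[i])
    (f g : K) :
  boundary_form (f, a *: f) (g, c *: g) = 'i * (conjC c - a) * '[f, g].
Proof. by rewrite /boundary_form /= krein_formZl krein_formZr -mulrA mulrBl. Qed.

Section shtraus_equality.
Context {R : realType} {H K1 K2 : kreinType R}.
Variables (A1 : set ((H * K1) * (H * K1))) (A2 : set ((H * K2) * (H * K2))).

(** The eigenvector lifts to [A1]; the resulting [p] lies in the common Shtraus subspace, hence also
    comes from [A2]. *)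
Lemma shtraus_match z f :
    self_adjoint A1 -> finite_dimensional K1 -> shtraus A1 z = shtraus A2 z ->
    adjoint (restr_K A1) (f, z *: f) ->
  exists p g, A1 (oplus p (f, z *: f)) /\ A2 (oplus p (g, z *: g)).
Proof.
move=> sA fK eqT /(adjoint_restr_K_lift sA fK) [p Ap].
have /shtrausP : shtraus A1 z p by apply/shtrausP; exists f.
have : shtraus A1 z p by apply/shtrausP; exists f.
by rewrite eqT => /shtrausP [g Ag] _; exists p, g.
Qed.

End shtraus_equality.

Section equivalence.
Context {R : realType} {H K1 K2 : kreinType R} {S : set (H * H)}.
Variables (A1 : set ((H * K1) * (H * K1))) (A2 : set ((H * K2) * (H * K2))).
Hypotheses (A1_class : class_A S A1) (A2_class : class_A S A2).

Lemma shtraus_equivalent :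
  (forall z, shtraus A1 z = shtraus A2 z) -> equivalent_extensions A1 A2.
Proof.
move=> eqT; case: A1_class A2_class => [sA1 _ f1 o1 e1] [sA2 _ f2 o2 e2].
have z_inj := @upper_point_inj R[i].
pose z := @upper_point R[i].
pose E : set (K1 * K2) := [set x | exists j p,
  A1 (oplus p (x.1, z j *: x.1)) /\ A2 (oplus p (x.2, z j *: x.2))].
have Eiso x y : E x -> E y -> '[x.1, y.1] = '[x.2, y.2].
  move=> [j [p [A1p A2p]]] [k [q [A1q A2q]]].
  (* Both inner products, times the same nonzero factor, equal minus the boundary form of [p] and
     [q]. *)
  have := self_adjoint_form sA1 A1p A1q.
  rewrite (self_adjoint_form sA2 A2p A2q) => /oppr_inj.
  rewrite !boundary_form_eigenvectors => /esym; apply: mulfI.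
  by rewrite mulf_neq0 ?neq0Ci // upper_point_conj.
have [||Psi [PsiI PsiE]] := isometry_extension Eiso.
- move=> W sW EW; apply: (eigenvector_span f1 z_inj (restr_K_subspace sA1)) => //.
  move=> j f /(shtraus_match sA1 f1 (eqT _)) [p [g [A1f A2g]]].
  by apply: (EW (f, g)); exists j, p.
- move=> W sW EW; apply: (eigenvector_span f2 z_inj (restr_K_subspace sA2)) => //.
  move=> j g /(shtraus_match sA2 f2 (esym (eqT _))) [p [f [A2g A1f]]].
  by apply: (EW (f, g)); exists j, p.
exists Psi; split => //; apply/equivalent_extensionsP; first by case: PsiI.
(* Here [p] lies in the Shtraus subspace at [z 0]; its partner [g] in [K2] is matched with 0, so
   [g = Psi 0 = 0]. *)
have A120 p : A1 (oplus p 0) -> A2 (oplus p 0).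
  move=> A1p; have : shtraus A1 (z 0%N) p.
    by apply/shtrausP; exists 0; rewrite scaler0.
  rewrite eqT => /shtrausP [g A2g].
  have /PsiE /= : E (0, g) by exists 0%N, p; rewrite scaler0.
  by rewrite linear0 => g0; move: A2g; rewrite -g0 scaler0.
have A12 p q : A1 (oplus p q) -> A2 (oplus p (Psi q.1, Psi q.2)).
  pose W : set (K1 * K1) := [set q | exists p,
    A1 (oplus p q) /\ A2 (oplus p (Psi q.1, Psi q.2))].
  have sW : linear_subspace W.
    split=> [|a r r' [p1 [A1p A2p]] [p2 [A1p' A2p']]].
      exists 0; rewrite /= linear0.
      by split; [case: (self_adjoint_subspace sA1) | case: (self_adjoint_subspace sA2)].
    exists (a *: p1 + p2); split; first exact: oplusD.
    by have := oplusD sA2 a A2p A2p'; rewrite /= !linearP.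
  (* The element found over [q] may have another part [p'] in [H^2], but [p - p'] lies in
     [restr_H A1] and is transferred by [A120]. *)
  move=> Apq; have [p' [A1p' A2p']] : W q.
    apply: (adjoint_span f1 z_inj (restr_K_subspace sA1) o1 e1 sW); last first.
      exact: adjoint_restr_K Apq.
    move=> j f /(shtraus_match sA1 f1 (eqT _)) [p' [g [A1f A2g]]].
    have /PsiE /= Psif : E (f, g) by exists j, p'.
    by exists p'; split=> //=; rewrite linearZ Psif.
  have := oplusB sA1 Apq A1p'; rewrite subrr => /A120 A2pp'.
  by have := oplusD sA2 1 A2pp' A2p'; rewrite !scale1r subrK add0r.
move=> p q; split=> [|A2pq]; first exact: A12.
(* Since [A12] sends [A1] into [A2], symmetry of [A2] and isometry of [Psi] place [oplus p q] in the
   adjoint of [A1]. *)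
rewrite sA1; apply/adjointP => x; rewrite (oplus_surjective x) => A1x.
rewrite boundary_form_oplus (self_adjoint_form sA2 (A12 _ _ A1x) A2pq).
by rewrite /boundary_form /= !(proj2 PsiI) addNr.
Qed.

End equivalence.

Section equivalent_extensions_theory.
Context {R : realType} {H K1 K2 : kreinType R}.
Variables (A1 : set ((H * K1) * (H * K1))) (A2 : set ((H * K2) * (H * K2))).

Lemma shtraus_inftyP (K : kreinType R) (A : set ((H * K) * (H * K))) p :
  shtraus_infty A p <-> exists g, A (oplus p (0, g)).
Proof.
split=> [[[f1 f2] [[g1 g2] [Afg /= f20 ->]]]|[g Ag]].
  by exists g2; rewrite -f20.
by exists (p.1, 0), (p.2, g); split; rewrite // -surjective_pairing.
Qed.

Hypothesis A12 : equivalent_extensions A1 A2.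

Lemma equivalent_shtraus z : shtraus A1 z = shtraus A2 z.
Proof.
have [Psi [[bPsi _] /(equivalent_extensionsP _ _ bPsi) PsiA]] := A12.
have [Phi PhiK PsiK] := bPsi.
apply/seteqP; split=> p /shtrausP [f Af]; apply/shtrausP.
  by exists (Psi f); rewrite -linearZ; exact/(PsiA p (f, z *: f)).
by exists (Phi f); apply/PsiA; rewrite /= linearZ /= PsiK.
Qed.

Lemma equivalent_shtraus_infty : shtraus_infty A1 = shtraus_infty A2.
Proof.
have [Psi [[bPsi _] /(equivalent_extensionsP _ _ bPsi) PsiA]] := A12.
have [Phi PhiK PsiK] := bPsi.
apply/seteqP; split=> p /shtraus_inftyP [g Ag]; apply/shtraus_inftyP.
  by exists (Psi g); rewrite -(linear0 Psi); exact/(PsiA p (0, g)).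
by exists (Phi g); apply/PsiA; rewrite /= linear0 PsiK.
Qed.

End equivalent_extensions_theory.

(** * The boundary mapping induced on the complement *)

Section hat_boundary_mappings.
Context {R : realType} {H K : kreinType R}.
Variable A : set ((H * K) * (H * K)).
Hypotheses (A_sa : self_adjoint A) (K_fin : finite_dimensional K).
Variables (n : nat) (b0 : H * H -> 'cV[R[i]]_n) (Q0 : 'M[R[i]]_n).
Implicit Types (p : H * H) (q : K * K).

(** Here [p - p'] lies in [restr_H A], the kernel of [b0]; this makes [- b0 p] a well-defined
    function of [q]. *)
Lemma boundary_mapping_fiber p q p' :
    boundary_mapping (restr_H A) b0 -> A (oplus p q) -> A (oplus p' q) ->
  b0 p = b0 p'.
Proof.
move=> [b0P _ b0K] Ap Ap'; have := oplusB A_sa Ap Ap'; rewrite subrr => App'.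
have : restr_H A (p - p') by [].
rewrite -b0K => -[Spp' b0pp'].
have := b0P 1 (p - p') p' Spp' (adjoint_restr_H A_sa Ap').
by rewrite b0pp' scaler0 add0r scale1r subrK.
Qed.

(** [H] may be infinite-dimensional, so duality is applied to the values of [b0], with the form of
    [Q0]. A value orthogonal to all those attained on [A] is [b0 r] with [oplus r 0] in the adjoint
    of [A], hence zero. So [b0 p = b0 p'] for some [p'] in the projection of [A], and [p - p'] lies
    in [restr_H A]. *)
Lemma adjoint_restr_H_lift p :
    boundary_mapping (restr_H A) b0 -> gram_matrix (restr_H A) b0 Q0 ->
  adjoint (restr_H A) p -> exists q, A (oplus p q).
Proof.
move=> [b0P b0S b0K] [Q0U _ Q0P] Ap.
pose f (u v : 'cV[R[i]]_n) := (v^t* *m Q0 *m u) 0 0.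
have cV_fin : finite_dimensional 'cV[R[i]]_n.
  exists n, (fun i => delta_mx i 0) => x; exists (fun i => x i 0).
  by rewrite [LHS]matrix_sum_delta; apply: eq_bigr => i _; rewrite big_ord1.
pose W : set 'cV[R[i]]_n := [set v | exists p q, A (oplus p q) /\ b0 p = v].
have [p' [q [Apq bp']]] : W (b0 p).
  apply: (double_orthogonal cV_fin (f := f)).
  - by move=> a x y z; rewrite /f mulmxDr -scalemxAr !mxE.
  - move=> a x y z; rewrite /f linearP /= map_mxD map_mxZ.
    by rewrite !mulmxDl -!scalemxAl !mxE.
  - move=> x fx; suff Q0x : Q0 *m x = 0 by rewrite -[x](mulKmx Q0U) Q0x mulmx0.
    apply/matrixP => i j; rewrite (ord1 j) [RHS]mxE; have := fx (delta_mx i 0).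
    by rewrite /f -mulmxA trmx_delta map_delta_mx -rowE [row _ _ _ _]mxE.
  - split=> [|a _ _ [r [s [Ars <-]]] [r' [s' [Ars' <-]]]].
      exists 0, 0; split; first by case: (self_adjoint_subspace A_sa).
      have h0 : restr_H A 0 by case: (restr_H_subspace A_sa).
      by move: h0; rewrite -b0K => -[].
    exists (a *: r + r'), (a *: s + s'); split; first exact: oplusD.
    exact: b0P (adjoint_restr_H A_sa Ars) (adjoint_restr_H A_sa Ars').
  move=> v Wv; have [r Ar rv] := b0S v; suff -> : v = 0.
    by rewrite /f trmx0 map_mx0 !mul0mx mxE.
  have : restr_H A r.
    rewrite /restr_H /= A_sa; apply/adjointP => x Ax.
    rewrite (oplus_surjective x) -[((r.1, 0), _)]/(oplus r 0) boundary_form_oplus.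
    have Ax1 : adjoint (restr_H A) (x.1.1, x.2.1).
      by apply: (@adjoint_restr_H _ _ _ _ A_sa _ (x.1.2, x.2.2)); rewrite -oplus_surjective.
    rewrite Q0P // rv [X in X + _]Wv; last first.
      by exists (x.1.1, x.2.1), (x.1.2, x.2.2); rewrite -oplus_surjective.
    by rewrite /boundary_form !krein_form0r subrr mulr0 addr0.
  by rewrite -b0K -rv => -[].
have : restr_H A (p - p').
  have Ap' := adjoint_restr_H A_sa Apq.
  rewrite -b0K; split; first exact: subspaceB (adjoint_subspace _) Ap Ap'.
  by rewrite -scaleN1r addrC b0P // bp' scaleN1r addNr.
move=> App'; exists q.
have := @oplusD _ _ _ _ A_sa 1 (p - p') 0 p' q App' Apq.
by rewrite !scale1r subrK add0r.
Qed.

Hypotheses (b0_bm : boundary_mapping (restr_H A) b0)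
  (Q0_gram : gram_matrix (restr_H A) b0 Q0).

Lemma hat_boundary_mapping_oplus bh p q :
  hat_boundary_mapping A b0 Q0 bh -> A (oplus p q) -> bh q = - b0 p.
Proof.
move=> [_ _ AE]; rewrite {1}AE => -[_ _]; rewrite /= -!surjective_pairing.
by rewrite addrC => /eqP; rewrite addr_eq0 => /eqP.
Qed.

(** [bh q] is [- b0 p] for any [p] with [oplus p q] in [A]. Lifting from [H] gives surjectivity; the
    Gram matrix is [- Q0] because the boundary forms of the two parts cancel. *)
Lemma hat_boundary_mapping_exists : exists bh, hat_boundary_mapping A b0 Q0 bh.
Proof.
have [b0P b0S b0K] := b0_bm; have [Q0U Q0H Q0P] := Q0_gram.
have /choice [h hP] q : exists p, adjoint (restr_K A) q -> A (oplus p q).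
  have [/(adjoint_restr_K_lift A_sa K_fin) [p Apq]|nAq] :=
    pselect (adjoint (restr_K A) q); first by exists p.
  by exists 0.
have hA q p : A (oplus p q) -> b0 (h q) = b0 p.
  move=> Apq; apply: (boundary_mapping_fiber b0_bm _ Apq).
  exact: hP (adjoint_restr_K A_sa Apq).
have hadj q : adjoint (restr_K A) q -> adjoint (restr_H A) (h q).
  by move=> /hP /(adjoint_restr_H A_sa).
have bhK q : adjoint (restr_K A) q /\ - b0 (h q) = 0 <-> restr_K A q.
  split=> [[Aq /eqP]|Aq].
    rewrite oppr_eq0 => /eqP b0h.
    have hS : restr_H A (h q) by rewrite -b0K; split=> //; exact: hadj.
    have := @oplusB _ _ _ _ A_sa (h q) q (h q) 0 (hP q Aq) hS.
    by rewrite subrr subr0.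
  split; first exact: (@adjoint_restr_K _ _ _ _ A_sa 0 q Aq).
  have /hA -> : A (oplus 0 q) by [].
  have : restr_H A 0 by case: (restr_H_subspace A_sa).
  by rewrite -b0K => -[_ ->]; rewrite oppr0.
exists (fun q => - b0 (h q)); split.
- split=> [a q q' Aq Aq'|v|].
  + rewrite (hA _ _ (oplusD A_sa a (hP _ Aq) (hP _ Aq'))).
    by rewrite b0P ?opprD ?scalerN //; exact: hadj.
  + have [p Ap bp] := b0S (- v); have [q Apq] := adjoint_restr_H_lift b0_bm Q0_gram Ap.
    by exists q; [exact (adjoint_restr_K A_sa Apq) | rewrite (hA _ _ Apq) bp opprK].
  + by apply/seteqP; split=> q /bhK.
- split.
  + by rewrite -scaleN1r unitmxZ ?unitrN1.
  + by rewrite linearN /= map_mxN Q0H.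
  move=> q q' Aq Aq'; apply: oppr_inj.
  rewrite -(self_adjoint_form A_sa (hP _ Aq) (hP _ Aq')).
  rewrite (Q0P _ _ (hadj _ Aq) (hadj _ Aq')).
  by rewrite [(- _)^T]linearN /= map_mxN !(mulNmx, mulmxN) opprK [in RHS]mxE opprK.
- apply/seteqP; split=> x; rewrite {1}(oplus_surjective x).
    move=> Ax; split; [exact (adjoint_restr_H A_sa Ax) | exact (adjoint_restr_K A_sa Ax) |].
    by rewrite (hA _ _ Ax) subrr.
(* The coupling condition puts [p - h q] in the kernel of [b0], so [p] may replace [h q] in [A]. *)
move=> -[Ap Aq /= /eqP]; set p := (x.1.1, x.2.1) in Ap *; set q := (x.1.2, x.2.2) in Aq *.
rewrite subr_eq0 => /eqP bpq; have Ahq := hP q Aq.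
have : restr_H A (p - h q).
  rewrite -b0K; split; first exact: subspaceB (adjoint_subspace _) Ap (hadj _ Aq).
  by rewrite -scaleN1r addrC b0P // ?bpq ?scaleN1r ?addNr //; exact: hadj.
move=> App'; have := @oplusD _ _ _ _ A_sa 1 (p - h q) 0 (h q) q App' Ahq.
by rewrite !scale1r subrK add0r (oplus_surjective x).
Qed.

End hat_boundary_mappings.

(** * Zero defect and the equivalence of the three statements *)

Lemma krein_isomorphism_adjoint (R : realType) (K1 K2 : kreinType R)
    (S1 : set (K1 * K1)) (S2 : set (K2 * K2)) (Theta : {linear K1 -> K2}) :
    krein_isomorphism Theta ->
    (forall q, S1 q <-> S2 (Theta q.1, Theta q.2)) ->
  forall q, adjoint S1 q <-> adjoint S2 (Theta q.1, Theta q.2).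
Proof.
move=> [[Phi ThetaK PhiK] ThetaI] S12 q; split=> Sq r.
  move=> S2r; have /Sq : S1 (Phi r.1, Phi r.2).
    by apply/S12; rewrite /= !PhiK -surjective_pairing.
  by rewrite /= -!ThetaI !PhiK.
by move=> /S12 /Sq /=; rewrite !ThetaI.
Qed.

Lemma defect_numbers0 (R : realType) (V : kreinType R) (S : set (V * V)) d :
  d = 0%N -> defect_numbers S d -> adjoint S `<=` S.
Proof.
move=> d0 [e [[_ eS _] _]] p /eS [c]; rewrite big1 ?subr0 // => -[i id].
by exfalso; rewrite d0 in id.
Qed.

(** The part in [H^2] of any element of [A] already lies in [A] and can be subtracted, so [A] splits
    as an orthogonal sum. *)
Lemma adjoint_subset_oplus (R : realType) (H K : kreinType R)
    (A : set ((H * K) * (H * K))) p q :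
    self_adjoint A -> adjoint (restr_H A) `<=` restr_H A ->
  A (oplus p q) <-> restr_H A p /\ restr_K A q.
Proof.
move=> sA AH; split=> [Apq|[Ap Aq]].
  have Ap : restr_H A p by apply: AH; exact (adjoint_restr_H sA Apq).
  split=> //; have := @oplusB _ _ _ _ sA p q p 0 Apq Ap.
  by rewrite subrr subr0.
have := @oplusD _ _ _ _ sA 1 p 0 0 q Ap Aq.
by rewrite !scale1r addr0 add0r.
Qed.

Theorem theorem4p8 (R : realType) (H : kreinType R) (S : set (H * H)) (d : nat)
    (b : H * H -> 'cV[R[i]]_(2 * d)) (Q : 'M[R[i]]_(2 * d))
    (d_gt0 : (0 < d)%N)
    (S_linear : linear_relation S) (S_closed : closed S)
    (S_symmetric : symmetric_relation S) (S_defect : defect_numbers S d)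
    (b_boundary : boundary_mapping S b) (Q_gram : gram_matrix S b Q)
    (K1 K2 : kreinType R)
    (A1 : set ((H * K1) * (H * K1))) (A2 : set ((H * K2) * (H * K2)))
    (A1_class : class_A S A1) (A2_class : class_A S A2)
    (d0 : nat) (B0 : 'M[R[i]]_(2 * d0, 2 * d))
    (d0_defect : defect_numbers (restr_H A1) d0)
    (B0_reduced : (0 < d0)%N ->
       reduced_boundary_mapping b Q B0 S (restr_H A1)) :
  let i := forall z : R[i], shtraus A1 z = shtraus A2 z in
  let ii := equivalent_extensions A1 A2 in
  let iii :=
    restr_H A1 = restr_H A2 /\
    exists Theta : {linear K1 -> K2},
      [/\ krein_isomorphism Theta,
          (graph Theta \; restr_K A1 = restr_K A2 \; graph Theta)%relation &
          (0 < d0)%N ->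
          exists bh1 bh2,
            [/\ hat_boundary_mapping A1 (reduced_map b B0)
                  (reduced_gram Q B0) bh1,
                hat_boundary_mapping A2 (reduced_map b B0)
                  (reduced_gram Q B0) bh2 &
                forall p, adjoint (restr_K A1) p ->
                  bh2 (Theta p.1, Theta p.2) = bh1 p]] in
  [/\ i <-> ii, ii <-> iii & i -> shtraus_infty A1 = shtraus_infty A2].
Proof.
move=> i ii iii.
have [sA1 _ f1 o1 e1] := A1_class; have [sA2 _ f2 o2 e2] := A2_class.
have i_ii : i -> ii by exact: shtraus_equivalent A1_class A2_class.
split; [split=> // ii_ z; exact: equivalent_shtraus | split |].
- move=> [Psi [PsiI /(equivalent_extensionsP _ _ (proj1 PsiI)) PsiA]].
  have eqH : restr_H A1 = restr_H A2.
    apply/seteqP; split=> p.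
      by move=> /(PsiA p 0); rewrite /= linear0.
    by move=> A2p; apply/(PsiA p 0); rewrite /= linear0.
  have PsiK q : restr_K A1 q <-> restr_K A2 (Psi q.1, Psi q.2) by exact: (PsiA 0 q).
  split=> //; exists Psi; split=> //.
    by apply/intertwiningP => //; case: PsiI.
  move=> /B0_reduced [_ _ b0_bm Q0_gram].
  have [bh1 bh1P] := hat_boundary_mapping_exists sA1 f1 b0_bm Q0_gram.
  have [||bh2 bh2P] := hat_boundary_mapping_exists sA2 f2
    (b0 := reduced_map b B0) (Q0 := reduced_gram Q B0).
  - by rewrite -eqH.
  - by rewrite -eqH.
  (* Both mappings take the value [- b0 p], for one [p] that [A1] couples with [q] and [A2] with the
     image of [q]. *)
  exists bh1, bh2; split=> // q /(adjoint_restr_K_lift sA1 f1) [p A1pq].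
  rewrite (hat_boundary_mapping_oplus bh1P A1pq).
  by apply: (hat_boundary_mapping_oplus bh2P); exact/PsiA.
- move=> [eqH [F [FI /(intertwiningP _ _ (proj1 FI)) FK bh]]].
  exists F; split=> //; apply/equivalent_extensionsP; first by case: FI.
  (* For [d0 = 0] both extensions are orthogonal sums of their restrictions, which [eqH] and [F]
     identify. *)
  have [d00|d0_gt0] := posnP d0.
    move=> p q; have AH := defect_numbers0 d00 d0_defect.
    rewrite (adjoint_subset_oplus p q sA1) // adjoint_subset_oplus // -eqH //.
    by split=> -[Ap /FK Aq].
  (* Both extensions are now given by the same coupling condition, whose ingredients [F]
     preserves. *)
  have [bh1 [bh2 [[_ _ A1E] [_ _ A2E] bh12]]] := bh d0_gt0.
  have adjK := krein_isomorphism_adjoint FI FK.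
  move=> p q; rewrite A1E A2E -eqH; split=> /= -[Ap Aq bpq].
    split=> //=; first exact/adjK.
    by move: bpq; rewrite -bh12.
  have {}Aq : adjoint (restr_K A1) (q.1, q.2) by apply/adjK.
  by split=> //=; rewrite -bh12.
- by move=> /i_ii; exact: equivalent_shtraus_infty.
Qed.
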